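(* Let $\mathbf{A}$ be a braided closed monoidal category with coproducts, and let $\hat{\mathcal{Q}}$ be a complete PMQ. Then the category $\mathbf{XA}(\hat{\mathcal{Q}})$ of $\hat{\mathcal{Q}}$-crossed objects in $\mathbf{A}$ is endowed with a braided monoidal structure, given as follows. The monoidal product is the Day convolution $$(X\otimes Y)(a)=\coprod_{b,c\in\hat{\mathcal{Q}},\,bc=a}X(b)\otimes Y(c),$$ where for $d\in\hat{\mathcal{Q}}$ the map $(-)^d\colon(X\otimes Y)(a)\to(X\otimes Y)(a^d)$ restricts to $(-)^d\otimes(-)^d\colon X(b)\otimes Y(c)\to X(b^d)\otimes Y(c^d)$ on the summand indexed by $(b,c)$. The monoidal unit has value $\mathbf{1}_{\mathbf{A}}$ (the monoidal unit of $\mathbf{A}$, with trivial action) at the unit $\mathbf{1}\in\hat{\mathcal{Q}}$, and the initial object of $\mathbf{A}$ at every $a\ne\mathbf{1}$. The braiding $X\otimes Y\to Y\otimes X$ restricts, on the summand indexed by $(b,c)$, to the composition $$X(b)\otimes Y(c)\xrightarrow{\ \mathfrak{br}_{X(b),Y(c)}\ }Y(c)\otimes X(b)\xrightarrow{\ \mathrm{Id}_{Y(c)}\otimes(-)^c\ }Y(c)\otimes X(b^c),$$ where $\mathfrak{br}$ is the braiding of $\mathbf{A}$.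
   Context: A complete PMQ is a set $\hat{\mathcal{Q}}$ with a monoid structure with unit $\mathbf{1}$ and an operation $(a,b)\mapsto a^b$ such that for all $a,b,c$: $(-)^a\colon\hat{\mathcal{Q}}\to\hat{\mathcal{Q}}$ is bijective; $\mathbf{1}^a=\mathbf{1}$, $a^{\mathbf{1}}=a$, $a^a=a$, $(a^b)^c=(a^c)^{(b^c)}$; $ab=b(a^b)$; $a^{(bc)}=(a^b)^c$; $(ab)^c=(a^c)(b^c)$. Let $\hat{\mathcal{Q}}/\!/\hat{\mathcal{Q}}$ be the category with object set $\hat{\mathcal{Q}}$, in which a morphism $a\to b$ is an element $c\in\hat{\mathcal{Q}}$ with $b=a^c$, the composite of $c\colon a\to a^c$ followed by $d\colon a^c\to(a^c)^d=a^{cd}$ being $cd$. A $\hat{\mathcal{Q}}$-crossed object in $\mathbf{A}$ is a functor $X\colon\hat{\mathcal{Q}}/\!/\hat{\mathcal{Q}}\to\mathbf{A}$, i.e. objects $X(a)$, $a\in\hat{\mathcal{Q}}$, with maps $(-)^b\colon X(a)\to X(a^b)$ compatible with composition; the maps $(-)^b$ are required to be isomorphisms. Morphisms in $\mathbf{XA}(\hat{\mathcal{Q}})$ are natural transformations. Coproducts indexed by subsets of $\hat{\mathcal{Q}}\times\hat{\mathcal{Q}}$ are assumed to exist in $\mathbf{A}$; since $\mathbf{A}$ is braided closed monoidal, $\otimes$ distributes over them in each variable. Associators and unitors are the evident ones induced from those of $\mathbf{A}$. *)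

(* Defs.v *)
From HB Require Import structures.
From mathcomp Require Import all_boot.
From mathcomp Require Import boolp.

Set Implicit Arguments.
Unset Strict Implicit.
Unset Printing Implicit Defensive.

Local Open Scope group_scope.

(* The underlying set of a monoidType is a choiceType; classically this is no *)
(* restriction on Q.                                                          *)

Reserved Notation "a ^^ b" (at level 29, left associativity).

HB.mixin Record Monoid_isCompletePMQ Q of Monoid Q := {
  pmq_conj : Q -> Q -> Q;
  pmq_conj_bij : forall a, bijective (fun x => pmq_conj x a);
  pmq_conj1l : forall a, pmq_conj 1 a = 1;
  pmq_conj1r : forall a, pmq_conj a 1 = a;
  pmq_conjxx : forall a, pmq_conj a a = a;
  pmq_conjJ : forall a b c : Q,
    pmq_conj (pmq_conj a b) c = pmq_conj (pmq_conj a c) (pmq_conj b c);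
  pmq_mul_conj : forall a b : Q, a * b = b * pmq_conj a b;
  pmq_conjMr : forall a b c : Q, pmq_conj a (b * c) = pmq_conj (pmq_conj a b) c;
  pmq_conjMl : forall a b c : Q,
    pmq_conj (a * b) c = pmq_conj a c * pmq_conj b c
}.

#[short(type="completePMQType")]
HB.structure Definition CompletePMQ :=
  { Q of Monoid_isCompletePMQ Q & Monoid Q }.

Notation "a ^^ b" := (pmq_conj a b) : group_scope.

Declare Scope cat_scope.
Delimit Scope cat_scope with cat.
Local Open Scope cat_scope.

(* Composition is written in diagrammatic order: f \; g is f followed by g.   *)
Record category := Category {
  ob :> Type;
  hom : ob -> ob -> Type;
  idm : forall a, hom a a;
  comp : forall a b c, hom a b -> hom b c -> hom a c;
  comp1m : forall a b (f : hom a b), comp (idm a) f = f;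
  compm1 : forall a b (f : hom a b), comp f (idm b) = f;
  compA : forall a b c d (f : hom a b) (g : hom b c) (h : hom c d),
    comp f (comp g h) = comp (comp f g) h
}.

Arguments hom {c0} a b : rename.
Arguments idm {c} a : rename.
Arguments comp {c a b c0} f g : rename.
Arguments comp1m {c a b} f : rename.
Arguments compm1 {c a b} f : rename.
Arguments compA {c a b c0 d} f g h : rename.

Notation "f \; g" := (comp f g) : cat_scope.

Definition is_iso (C : category) (a b : C) (f : hom a b) : Prop :=
  exists g : hom b a, f \; g = idm a /\ g \; f = idm b.

Record iso (C : category) (a b : C) := Iso {
  fwd :> hom a b;
  bwd : hom b a;
  fwdK : fwd \; bwd = idm a;
  bwdK : bwd \; fwd = idm b
}.

Record functor (C D : category) := Functor {
  fob :> C -> D;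
  fmap : forall a b : C, hom a b -> hom (fob a) (fob b);
  fmap_id : forall a : C, fmap (idm a) = idm (fob a);
  fmap_comp : forall (a b c : C) (f : hom a b) (g : hom b c),
    fmap (f \; g) = fmap f \; fmap g
}.

Record nattrans (C D : category) (F G : functor C D) := NatTrans {
  ntmap :> forall a : C, hom (F a) (G a);
  ntmap_nat : forall (a b : C) (f : hom a b),
    fmap F f \; ntmap b = ntmap a \; fmap G f
}.

(* A functor C x C -> C, in curried form. *)
Record bifunctor (C : category) := Bifunctor {
  bob :> C -> C -> C;
  bmap : forall a a' b b' : C,
    hom a a' -> hom b b' -> hom (bob a b) (bob a' b');
  bmap_id : forall a b : C, bmap (idm a) (idm b) = idm (bob a b);
  bmap_comp : forall (a a' a'' b b' b'' : C) (f : hom a a') (f' : hom a' a'')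
      (g : hom b b') (g' : hom b' b''),
    bmap (f \; f') (g \; g') = bmap f g \; bmap f' g'
}.

Record monoidal_structure (C : category) (T : bifunctor C) (I : C) := Monoidal {
  associator : forall X Y Z : C, iso (T (T X Y) Z) (T X (T Y Z));
  lunitor : forall X : C, iso (T I X) X;
  runitor : forall X : C, iso (T X I) X;
  associator_nat : forall (X X' Y Y' Z Z' : C)
      (f : hom X X') (g : hom Y Y') (h : hom Z Z'),
    bmap T (bmap T f g) h \; associator X' Y' Z'
      = associator X Y Z \; bmap T f (bmap T g h);
  lunitor_nat : forall (X X' : C) (f : hom X X'),
    bmap T (idm I) f \; lunitor X' = lunitor X \; f;
  runitor_nat : forall (X X' : C) (f : hom X X'),
    bmap T f (idm I) \; runitor X' = runitor X \; f;
  pentagon : forall W X Y Z : C,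
    associator (T W X) Y Z \; associator W X (T Y Z)
      = bmap T (associator W X Y) (idm Z) \; associator W (T X Y) Z
          \; bmap T (idm W) (associator X Y Z);
  triangle : forall X Y : C,
    associator X I Y \; bmap T (idm X) (lunitor Y)
      = bmap T (runitor X) (idm Y)
}.

Record braiding (C : category) (T : bifunctor C) (I : C)
    (M : monoidal_structure T I) := Braiding {
  br :> forall X Y : C, iso (T X Y) (T Y X);
  br_nat : forall (X X' Y Y' : C) (f : hom X X') (g : hom Y Y'),
    bmap T f g \; br X' Y' = br X Y \; bmap T g f;
  hexagon1 : forall X Y Z : C,
    associator M X Y Z \; br X (T Y Z) \; associator M Y Z X
      = bmap T (br X Y) (idm Z) \; associator M Y X Z
          \; bmap T (idm Y) (br X Z);
  hexagon2 : forall X Y Z : C,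
    bwd (associator M X Y Z) \; br (T X Y) Z \; bwd (associator M Z X Y)
      = bmap T (idm X) (br Y Z) \; bwd (associator M X Z Y)
          \; bmap T (br X Z) (idm Y)
}.

(* Every functor T - Y has a right adjoint ihom Y -. In the presence of a     *)
(* braiding, so has every functor T X -.                                      *)
Record closed_structure (C : category) (T : bifunctor C) := Closed {
  ihom : C -> C -> C;
  ev : forall Y Z : C, hom (T (ihom Y Z) Y) Z;
  curry : forall X Y Z : C, hom (T X Y) Z -> hom X (ihom Y Z);
  curryK : forall (X Y Z : C) (f : hom (T X Y) Z),
    bmap T (curry f) (idm Y) \; ev Y Z = f;
  curry_uniq : forall (X Y Z : C) (f : hom (T X Y) Z) (g : hom X (ihom Y Z)),
    bmap T g (idm Y) \; ev Y Z = f -> g = curry f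
}.

Record coproduct (C : category) (J : Type) (F : J -> C) := Coproduct {
  coprod :> C;
  coprod_in : forall j, hom (F j) coprod;
  cotuple : forall Z : C, (forall j, hom (F j) Z) -> hom coprod Z;
  coprod_inK : forall (Z : C) (f : forall j, hom (F j) Z) j,
    coprod_in j \; cotuple f = f j;
  cotuple_uniq : forall (Z : C) (f : forall j, hom (F j) Z) (h : hom coprod Z),
    (forall j, coprod_in j \; h = f j) -> h = cotuple f
}.

(* A choice of coproducts indexed by the subsets of a given type. *)
Definition subset_coproducts (C : category) (U : Type) : Type :=
  forall (S : U -> Prop) (F : {u | S u} -> C), coproduct F.

Lemma coprod_ext (C : category) (J : Type) (F : J -> C) (K : coproduct F)
    (Z : C) (h h' : hom K Z) :
  (forall j, coprod_in K j \; h = coprod_in K j \; h') -> h = h'.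
Proof.
move=> e; rewrite (cotuple_uniq (f := fun j => coprod_in K j \; h') e).
by symmetry; apply: cotuple_uniq.
Qed.

Lemma nattrans_ext (C D : category) (F G : functor C D) (s t : nattrans F G) :
  (forall a, s a = t a) -> s = t.
Proof.
case: s t => [s es] [t et] /= e.
have {}e : s = t by apply: functional_extensionality_dep.
by subst t; congr NatTrans; apply: Prop_irrelevance.
Qed.

Section ActionCategory.
Variable Q : completePMQType.

(* Q // Q. Keeping the target b of a morphism arbitrary, with b = a ^^ c, and  *)
(* likewise the value a of the product bc in day_in below, avoids transports  *)
(* along equations such as (a ^^ c) ^^ d = a ^^ (c * d).                      *)
Definition action_hom (a b : Q) : Type := {c : Q | b = a ^^ c}.

Lemma action_hom_ext (a b : Q) (f g : action_hom a b) : sval f = sval g -> f = g.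
Proof. by case: f g => [c ec] [d ed] /= e; apply: eq_exist. Qed.

Definition action_id (a : Q) : action_hom a a :=
  exist _ 1 (esym (pmq_conj1r a)).

Lemma action_comp_subproof (a b c : Q) (f : action_hom a b) (g : action_hom b c) :
  c = a ^^ (sval f * sval g).
Proof. by rewrite pmq_conjMr -(svalP f) -(svalP g). Qed.

Definition action_comp (a b c : Q) (f : action_hom a b) (g : action_hom b c) :
  action_hom a c := exist _ (sval f * sval g) (action_comp_subproof f g).

Fact action_comp1m (a b : Q) (f : action_hom a b) :
  action_comp (action_id a) f = f.
Proof. by apply: action_hom_ext; rewrite /= mul1g. Qed.

Fact action_compm1 (a b : Q) (f : action_hom a b) :
  action_comp f (action_id b) = f.
Proof. by apply: action_hom_ext; rewrite /= mulg1. Qed.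

Fact action_compA (a b c d : Q)
    (f : action_hom a b) (g : action_hom b c) (h : action_hom c d) :
  action_comp f (action_comp g h) = action_comp (action_comp f g) h.
Proof. by apply: action_hom_ext; rewrite /= mulgA. Qed.

Definition action_category : category :=
  @Category Q action_hom action_id action_comp
    action_comp1m action_compm1 action_compA.

Definition acting (a c : Q) : @hom action_category a (a ^^ c) :=
  exist _ c erefl.

End ActionCategory.

Section CrossedObjects.
Variables (Q : completePMQType) (A : category).

Record crossed_object := CrossedObject {
  crossed_functor :> functor (action_category Q) A;
  crossed_iso : forall (a b : action_category Q) (f : hom a b),
    is_iso (fmap crossed_functor f)
}.

Definition crossed_id (X : crossed_object) : nattrans X X.
Proof.
exists (fun a => idm (X a)) => a b f.
by rewrite comp1m compm1.
Defined.

Definition crossed_comp (X Y Z : crossed_object)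
  (s : nattrans X Y) (t : nattrans Y Z) : nattrans X Z.
Proof.
exists (fun a => s a \; t a) => a b f.
by rewrite compA ntmap_nat -compA ntmap_nat compA.
Defined.

Fact crossed_comp1m (X Y : crossed_object) (s : nattrans X Y) :
  crossed_comp (crossed_id X) s = s.
Proof. by apply: nattrans_ext => a; apply: comp1m. Qed.

Fact crossed_compm1 (X Y : crossed_object) (s : nattrans X Y) :
  crossed_comp s (crossed_id Y) = s.
Proof. by apply: nattrans_ext => a; apply: compm1. Qed.

Fact crossed_compA (X Y Z W : crossed_object)
    (s : nattrans X Y) (t : nattrans Y Z) (u : nattrans Z W) :
  crossed_comp s (crossed_comp t u) = crossed_comp (crossed_comp s t) u.
Proof. by apply: nattrans_ext => a; apply: compA. Qed.

Definition crossed_category : category :=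
  @Category crossed_object (fun X Y => nattrans X Y) crossed_id crossed_comp
    crossed_comp1m crossed_compm1 crossed_compA.

Definition component (X Y : crossed_object)
    (s : @hom crossed_category X Y) (a : Q) : hom (X a) (Y a) :=
  ntmap s a.

End CrossedObjects.

Section DayConvolution.
Variables (Q : completePMQType) (A : category) (T : bifunctor A) (I : A).
Variable cop : subset_coproducts A (Q * Q).

Local Notation QQ := (action_category Q).
Local Notation XA := (crossed_category Q A).

Definition factors (a : Q) (p : Q * Q) : Prop := p.1 * p.2 = a.

Section Objects.
Variables X Y : crossed_object Q A.

Definition day_summand (a : Q) (j : {p | factors a p}) : A :=
  T (X (sval j).1) (Y (sval j).2).

Definition day_ob (a : Q) : coproduct (@day_summand a) := cop (@day_summand a).

Definition day_in (b c a : Q) (e : b * c = a) :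
    hom (T (X b) (Y c)) (day_ob a) :=
  coprod_in (day_ob a) (exist (factors a) (b, c) e).

Lemma day_inK (a : Q) (Z : A) (f : forall j, hom (@day_summand a j) Z)
    (b c : Q) (e : b * c = a) :
  day_in e \; cotuple (day_ob a) f = f (exist (factors a) (b, c) e).
Proof. exact (coprod_inK (day_ob a) f (exist (factors a) (b, c) e)). Qed.

Lemma day_ext (a : Q) (Z : A) (h h' : hom (day_ob a) Z) :
  (forall b c (e : b * c = a), day_in e \; h = day_in e \; h') -> h = h'.
Proof. by move=> eh; apply: coprod_ext => -[[b c] e]; apply: eh. Qed.

Lemma day_act_subproof (a a' : Q) (f : @hom QQ a a') (b c : Q) :
  b * c = a -> b ^^ sval f * c ^^ sval f = a'.
Proof. by move=> e; rewrite -pmq_conjMl e -(svalP f). Qed.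

Definition day_act (a a' : QQ) (f : hom a a') : hom (day_ob a) (day_ob a') :=
  cotuple (day_ob a) (fun j : {p | factors a p} =>
    bmap T (fmap X (acting (sval j).1 (sval f)))
           (fmap Y (acting (sval j).2 (sval f)))
    \; day_in (day_act_subproof f (svalP j))).

Lemma day_actE (a a' : Q) (f : @hom QQ a a') (b c b' c' : Q)
    (e : b * c = a) (e' : b' * c' = a')
    (g : @hom QQ b b') (h : @hom QQ c c') :
  sval g = sval f -> sval h = sval f ->
  day_in e \; day_act f = bmap T (fmap X g) (fmap Y h) \; day_in e'.
Proof.
move=> eg eh; rewrite /day_act day_inK /=.
case: g eg => d eb /= ed; case: h eh => d' ec /= ed'; subst d d' b' c'.
by congr (_ \; day_in _); apply: Prop_irrelevance.
Qed.

Fact day_act_id (a : QQ) : day_act (idm a) = idm _.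
Proof.
apply: day_ext => b c e.
rewrite (day_actE (f := @idm QQ a) e e (g := @idm QQ b) (h := @idm QQ c)) //.
by rewrite !fmap_id bmap_id comp1m compm1.
Qed.

Fact day_act_comp (a a' a'' : QQ) (f : hom a a') (g : hom a' a'') :
  day_act (f \; g) = day_act f \; day_act g.
Proof.
apply: day_ext => b c e; rewrite compA.
have e1 := day_act_subproof f e; have e2 := day_act_subproof g e1.
rewrite (day_actE e e1 (g := acting b (sval f)) (h := acting c (sval f))) //.
rewrite -compA (day_actE e1 e2 (g := acting _ (sval g)) (h := acting _ (sval g))) //.
rewrite compA -bmap_comp -!fmap_comp.
exact: day_actE.
Qed.

Definition day_functor : functor QQ A :=
  Functor day_act_id day_act_comp.

Fact day_iso (a a' : QQ) (f : hom a a') : is_iso (fmap day_functor f).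
Proof.
have [u uK Ku] := pmq_conj_bij (sval f).
have ex (Z : crossed_object Q A) (b : Q) : {v : hom (Z b) (Z (u b)) |
    forall g : @hom QQ (u b) b, sval g = sval f ->
      fmap Z g \; v = idm _ /\ v \; fmap Z g = idm _}.
  apply: cid; have eb : b = u b ^^ sval f by rewrite Ku.
  have [v ev] := crossed_iso Z (exist _ (sval f) eb : @hom QQ (u b) b).
  exists v => g eg; rewrite (_ : g = exist _ (sval f) eb) //.
  exact: action_hom_ext.
have eu b c : b * c = a' -> u b * u c = a.
  move=> e; apply: (can_inj uK); rewrite pmq_conjMl !Ku e; exact: (svalP f).
pose w (j : {p | factors a' p}) : hom (day_summand j) (day_ob a) :=
  bmap T (sval (ex X (sval j).1)) (sval (ex Y (sval j).2))
    \; day_in (eu _ _ (svalP j)).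
have wE b c (e : b * c = a') : day_in e \; cotuple (day_ob a') w
    = bmap T (sval (ex X b)) (sval (ex Y c)) \; day_in (eu _ _ e).
  rewrite (day_inK w e) /w /=; congr (_ \; day_in _); apply: Prop_irrelevance.
exists (cotuple (day_ob a') w).
split; apply: day_ext => b c e; rewrite compm1 compA.
- have [b' eb] : exists b', b = u b' by exists (b ^^ sval f); rewrite uK.
  have [c' ec] : exists c', c = u c' by exists (c ^^ sval f); rewrite uK.
  subst b c.
  have gb : b' = u b' ^^ sval f by rewrite Ku.
  have gc : c' = u c' ^^ sval f by rewrite Ku.
  have e' : b' * c' = a'.
    by rewrite gb gc -pmq_conjMl e -(svalP f).
  pose g : @hom QQ (u b') b' := exist _ (sval f) gb.
  pose h : @hom QQ (u c') c' := exist _ (sval f) gc.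
  rewrite (day_actE e e' (g := g) (h := h)) // -compA wE compA -bmap_comp.
  have [-> _] := svalP (ex X b') g erefl.
  have [-> _] := svalP (ex Y c') h erefl.
  by rewrite bmap_id comp1m; congr day_in; apply: Prop_irrelevance.
- rewrite wE -compA.
  have gb : b = u b ^^ sval f by rewrite Ku.
  have gc : c = u c ^^ sval f by rewrite Ku.
  pose g : @hom QQ (u b) b := exist _ (sval f) gb.
  pose h : @hom QQ (u c) c := exist _ (sval f) gc.
  rewrite (day_actE (eu _ _ e) e (g := g) (h := h)) // compA -bmap_comp.
  have [_ ->] := svalP (ex X b) g erefl.
  have [_ ->] := svalP (ex Y c) h erefl.
  by rewrite bmap_id comp1m.
Qed.

Definition day_object : crossed_object Q A := CrossedObject day_iso.

End Objects.

Definition day_map_at (X X' Y Y' : crossed_object Q A)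
    (s : nattrans X X') (t : nattrans Y Y') (a : Q) :
    hom (day_ob X Y a) (day_ob X' Y' a) :=
  cotuple (day_ob X Y a) (fun j : {p | factors a p} =>
    bmap T (s (sval j).1) (t (sval j).2) \; day_in X' Y' (svalP j)).

Lemma day_map_atE (X X' Y Y' : crossed_object Q A)
    (s : nattrans X X') (t : nattrans Y Y') (a b c : Q) (e : b * c = a) :
  day_in X Y e \; day_map_at s t a = bmap T (s b) (t c) \; day_in X' Y' e.
Proof.
rewrite /day_map_at day_inK /=.
by congr (_ \; day_in _ _ _); apply: Prop_irrelevance.
Qed.

Definition day_map (X X' Y Y' : crossed_object Q A)
    (s : nattrans X X') (t : nattrans Y Y') :
  nattrans (day_object X Y) (day_object X' Y').
Proof.
exists (day_map_at s t) => a a' f.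
apply: day_ext => b c e; rewrite !compA day_map_atE.
have e' := day_act_subproof f e.
rewrite (day_actE X Y e e' (g := acting b (sval f)) (h := acting c (sval f))) //.
rewrite -!compA day_map_atE.
rewrite (day_actE X' Y' e e' (g := acting b (sval f)) (h := acting c (sval f))) //.
by rewrite !compA -!bmap_comp !ntmap_nat.
Defined.

Fact day_map_id (X Y : XA) :
  day_map (idm X) (idm Y) = idm (day_object X Y : XA).
Proof.
apply: nattrans_ext => a; apply: day_ext => b c e.
by rewrite day_map_atE /= bmap_id comp1m compm1.
Qed.

Fact day_map_comp (X X' X'' Y Y' Y'' : XA) (s : hom X X') (s' : hom X' X'')
    (t : hom Y Y') (t' : hom Y' Y'') :
  day_map (s \; s') (t \; t') = (day_map s t : @hom XA _ _) \; day_map s' t'.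
Proof.
apply: nattrans_ext => a; apply: day_ext => b c e.
by rewrite /= compA !day_map_atE bmap_comp -!compA day_map_atE.
Qed.

Definition day_tensor : bifunctor XA :=
  @Bifunctor XA day_object day_map day_map_id day_map_comp.

(* The initial object of A, as the coproduct indexed by the empty subset. *)
Definition initial : coproduct _ :=
  cop (S := fun=> False) (fun j => False_rect A (svalP j)).

Definition from_initial (Z : A) : hom initial Z :=
  cotuple initial (fun j => False_rect _ (svalP j)).

Lemma from_initial_uniq (Z : A) (f g : hom initial Z) : f = g.
Proof. by apply: coprod_ext => -[]. Qed.

Definition day_unit_ob (a : Q) : A := if a == 1 then I else initial.

Lemma day_unit_act_subproof (a b : Q) (f : @hom QQ a b) : a == 1 -> b == 1.
Proof. by case: f => c -> /eqP->; rewrite pmq_conj1l. Qed.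

(* The identity of I if a = 1 (hence b = 1), and the unique map out of the    *)
(* initial object otherwise.                                                  *)
Definition day_unit_act (a b : QQ) (f : hom a b) :
  hom (day_unit_ob a) (day_unit_ob b) :=
  match a == 1 :> Q as s, b == 1 :> Q as t return
    (s -> t) -> hom (if s then I else initial) (if t then I else initial)
  with
  | true, true => fun=> idm I
  | true, false => fun h => False_rect _ (notF (h isT))
  | false, _ => fun=> from_initial _
  end (@day_unit_act_subproof a b f).

Fact day_unit_act_id (a : QQ) : day_unit_act (idm a) = idm _.
Proof.
rewrite /day_unit_act; move: (day_unit_act_subproof _).
rewrite /day_unit_ob; case: (a == 1) => // _.
exact: from_initial_uniq.
Qed.

Fact day_unit_act_comp (a b c : QQ) (f : hom a b) (g : hom b c) :
  day_unit_act (f \; g) = day_unit_act f \; day_unit_act g.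
Proof.
rewrite /day_unit_act.
move: (day_unit_act_subproof f) (day_unit_act_subproof g).
move: (day_unit_act_subproof (f \; g)).
rewrite /day_unit_ob; case: (a == 1); last by move=> *; apply: from_initial_uniq.
case: (b == 1) => [|h1 h2]; last by case: (notF (h2 isT)).
case: (c == 1) => [|h1 h2 h3]; last by case: (notF (h1 isT)).
by rewrite comp1m.
Qed.

Definition day_unit_functor : functor QQ A :=
  Functor day_unit_act_id day_unit_act_comp.

Lemma day_unit_eq1 (a b : Q) (f : @hom QQ a b) : (b == 1) = (a == 1).
Proof.
case: f => c ->; apply/eqP/eqP => [|->]; last exact: pmq_conj1l.
move=> e; apply: (bij_inj (pmq_conj_bij c)).
by rewrite e pmq_conj1l.
Qed.

Fact day_unit_iso (a b : QQ) (f : hom a b) : is_iso (fmap day_unit_functor f).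
Proof.
rewrite /= /day_unit_act /day_unit_ob; move: (day_unit_act_subproof f).
rewrite (day_unit_eq1 f); case: (a == 1) => h.
  by exists (idm I); rewrite comp1m.
by exists (idm initial); split; apply: from_initial_uniq.
Qed.

Definition day_unit : crossed_object Q A := CrossedObject day_unit_iso.

Definition day_unit1 : day_unit 1 = I :=
  congr1 (fun s : bool => if s then I else initial) (eqxx (1 : Q)).

(* The identity of I, transported along day_unit1. *)
Definition unit_in : hom I (day_unit 1) :=
  ecast J (hom I J) (esym day_unit1) (idm I).

End DayConvolution.

Arguments component {Q A X Y} s a.
Arguments day_in {Q A} T cop X Y {b c a} e.
Arguments unit_in {Q A} I cop.

(* bc = c(b^c) places the image of the summand (b, c) under the braiding.     *)
Lemma pmq_braid_eq (Q : completePMQType) (b c : Q) : c * b ^^ c = b * c.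
Proof. by rewrite -pmq_mul_conj. Qed.

(* Main.v *)
(* Closedness makes T - Y preserve coproducts, and the braiding transfers this *)
(* to T Y -, so a map out of an iterated Day convolution, in any bracketing,   *)
(* is determined by, and can be prescribed on, the summands indexed by tuples. *)
(* The unit object at b is a coproduct of copies of I indexed by the proofs of *)
(* b = 1, hence fits the same pattern. On summands every axiom reduces to the  *)
(* corresponding axiom of A together with an identity of Q: for equivariance   *)
(* of the braiding (b^c)^x = (b^x)^(c^x) and c x = x c^x, for the hexagons     *)
(* b^(cd) = (b^c)^d and (bc)^d = b^d c^d. The braiding is invertible because   *)
(* b |-> b^c is bijective and acts on X by isomorphisms.                       *)

From HB Require Import structures.
From mathcomp Require Import all_boot.
From mathcomp Require Import boolp.
Require Import Defs.

Set Implicit Arguments.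
Unset Strict Implicit.
Unset Printing Implicit Defensive.

Local Open Scope group_scope.
Local Open Scope cat_scope.

(** Every structure map is prescribed on summands, and every axiom is checked there. Closedness
    makes [T - Y] a left adjoint, so it preserves coproducts ([tensor_coprodl]), and the braiding of
    [A] carries this over to the other variable ([tensor_coprodr]). Hence an iterated Day
    convolution, in any bracketing, is the coproduct of the iterated tensor products of values over
    the tuples of elements with the given product. Its injections are jointly epic
    ([tensorl_day_ext], [day_ext3l], [day_ext3r]). The unit fits the same pattern through
    [day_unit_coprod].

    Each structure map then has a formula on summands ([day_assoc_atE], [day_lunit_atE],
    [day_runit_atE], [day_braid_atE]). Rewriting with these formulas and moving the injections to
    the end by naturality turns the pentagon and the triangle into those of [A]. The braiding also
    involves the action, and this is where the laws of [Q] enter: (b^c)^x = (b^x)^(c^x) and c x = x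
    c^x for equivariance, b^(cd) = (b^c)^d for the first hexagon, (bc)^d = b^d c^d for the second.
    It is invertible because each (-)^c is bijective on [Q] and acts on crossed objects by
    isomorphisms ([unact]). *)

(** * Rewriting inside composites, and inverses of naturality squares *)

Section Composition.
Variable C : category.

(** Composites are nested to the right; this rewrites their first two factors in front of a tail
    [k]. *)
Lemma compA2 (a b c d : C) (f : hom a b) (g : hom b c) (h : hom a c)
    (k : hom c d) : f \; g = h -> f \; g \; k = h \; k.
Proof. by move=> <-; rewrite compA. Qed.

Lemma compA3 (a b c d e : C) (f : hom a b) (g : hom b c) (h : hom c d)
    (s : hom a d) (k : hom d e) :
  f \; g \; h = s -> f \; g \; h \; k = s \; k.
Proof. by move=> <-; rewrite !compA. Qed.

Lemma fwdK_comp (a b c : C) (i : iso a b) (k : hom a c) : i \; bwd i \; k = k.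
Proof. by rewrite compA fwdK comp1m. Qed.

Lemma bwdK_comp (a b c : C) (i : iso a b) (k : hom b c) : bwd i \; i \; k = k.
Proof. by rewrite compA bwdK comp1m. Qed.

Lemma fwd_epi (a b c : C) (i : iso a b) (f g : hom b c) :
  i \; f = i \; g -> f = g.
Proof. by move=> e; rewrite -(bwdK_comp i f) e bwdK_comp. Qed.

Lemma iso_bwd_nat (a b a' b' : C) (i : iso a b) (i' : iso a' b')
    (f : hom a a') (g : hom b b') :
  f \; i' = i \; g -> g \; bwd i' = bwd i \; f.
Proof.
by move=> e; apply: (fwd_epi (i := i)); rewrite fwdK_comp compA -e -compA fwdK compm1.
Qed.

Variable T : bifunctor C.

Lemma bmap_comp_comp (a a' a'' b b' b'' c : C) (f : hom a a') (f' : hom a' a'')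
    (g : hom b b') (g' : hom b' b'') (k : hom (T a'' b'') c) :
  bmap T f g \; bmap T f' g' \; k = bmap T (f \; f') (g \; g') \; k.
Proof. by rewrite compA bmap_comp. Qed.

End Composition.

(** * The tensor product preserves coproducts in each variable *)

Section CoproductTensor.
Variables (A : category) (T : bifunctor A) (I : A) (M : monoidal_structure T I).
Variables (B : braiding M) (K : closed_structure T).

Section OneCoproduct.
Variables (J : Type) (F : J -> A) (P : coproduct F) (Y : A).

(** Naturality of the adjunction, a consequence of the uniqueness of transposes. *)
Lemma curry_natural (X X' Z : A) (f : hom X' X) (h : hom (T X Y) Z) :
  f \; curry K h = curry K (bmap T f (idm Y) \; h).
Proof.
apply: curry_uniq.
by rewrite -(comp1m (idm Y)) bmap_comp -compA curryK comp1m.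
Qed.

(** A left adjoint preserves coproducts: a family is transposed, cotupled out of [P], and transposed
    back. *)
Definition tensor_coprodl : coproduct (fun j => T (F j) Y).
Proof.
exists (T P Y) (fun j => bmap T (coprod_in P j) (idm Y))
  (fun Z f => bmap T (cotuple P (fun j => curry K (f j))) (idm Y) \; ev K Y Z).
- by move=> Z f j; rewrite compA -bmap_comp coprod_inK comp1m curryK.
- move=> Z f h eh; rewrite -[LHS](curryK K); congr (bmap T _ _ \; _).
  by apply: cotuple_uniq => j; rewrite curry_natural eh.
Defined.

Definition tensor_coprodr : coproduct (fun j => T Y (F j)).
Proof.
exists (T Y P) (fun j => bmap T (idm Y) (coprod_in P j))
  (fun Z f => B Y P \; cotuple tensor_coprodl (fun j => bwd (B Y (F j)) \; f j)).
- move=> Z f j; rewrite compA br_nat -compA.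
  by rewrite (coprod_inK tensor_coprodl) fwdK_comp.
(* Precomposition with [B P Y] moves the question to [T P Y]. The resulting double braiding need not
   be the identity, but it is natural, so it moves past the injections. *)
- move=> Z f h eh; apply: (fwd_epi (i := B P Y)).
  apply: (coprod_ext (K := tensor_coprodl)) => j /=.
  rewrite [LHS]compA [RHS]compA !br_nat -!compA eh.
  rewrite (compA2 _ (br_nat _ _ _)) -compA.
  by rewrite (coprod_inK tensor_coprodl) fwdK_comp.
Defined.

End OneCoproduct.
End CoproductTensor.

(** * Isomorphisms of crossed objects, componentwise *)

Section Crossed.
Variables (Q : completePMQType) (A : category).
Local Notation XA := (crossed_category Q A).

Lemma fmap_acting (X : crossed_object Q A) (a b : Q)
    (f g : @hom (action_category Q) a b) :
  sval f = sval g -> fmap X f = fmap X g.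
Proof. by move=> e; rewrite (action_hom_ext e). Qed.

Section IsoOfComponents.
Variables (X Y : XA) (s : hom X Y) (v : forall a : Q, hom (Y a) (X a)).
Hypothesis (sv : forall a, component s a \; v a = idm (X a)).
Hypothesis (vs : forall a, v a \; component s a = idm (Y a)).

(** Pointwise inverses of a natural transformation are automatically natural, so equivariance of an
    inverse is never checked by hand. *)
Definition componentwise_inverse : hom Y X.
Proof.
exists v => a b f.
have /(iso_bwd_nat (i := Iso (sv a) (vs a)) (i' := Iso (sv b) (vs b))) := ntmap_nat s f.
exact.
Defined.

Definition componentwise_iso : iso X Y.
Proof.
by exists s componentwise_inverse; apply: nattrans_ext => a; rewrite /= (sv, vs).
Defined.

End IsoOfComponents.
End Crossed.

(** * Maps out of iterated Day convolutions are determined on summands *)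

Section DayBraided.
Variables (Q : completePMQType) (A : category) (T : bifunctor A) (I : A).
Variables (M : monoidal_structure T I) (B : braiding M) (K : closed_structure T).
Variable cop : subset_coproducts A (Q * Q).

Local Notation QQ := (action_category Q).
Local Notation XA := (crossed_category Q A).
Local Notation day_in := (day_in T cop).
Local Notation day_ob := (day_ob T cop).
Local Notation day_object := (day_object T cop).
Local Notation day_unit := (day_unit I cop).
Local Notation day_tensor := (day_tensor T cop).

Lemma tensorl_day_ext (X Y : crossed_object Q A) (p : Q) (U V : A)
    (h h' : hom (T (day_ob X Y p) U) V) :
  (forall b c (e : b * c = p), bmap T (day_in X Y e) (idm U) \; h
     = bmap T (day_in X Y e) (idm U) \; h') -> h = h'.
Proof.
move=> eh; apply: (coprod_ext (K := tensor_coprodl K (day_ob X Y p) U)).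
by move=> -[[b c] e]; apply: eh.
Qed.

Lemma tensorr_day_ext (X Y : crossed_object Q A) (p : Q) (U V : A)
    (h h' : hom (T U (day_ob X Y p)) V) :
  (forall b c (e : b * c = p), bmap T (idm U) (day_in X Y e) \; h
     = bmap T (idm U) (day_in X Y e) \; h') -> h = h'.
Proof.
move=> eh; apply: (coprod_ext (K := tensor_coprodr B K (day_ob X Y p) U)).
by move=> -[[b c] e]; apply: eh.
Qed.

(** Reaches the innermost factor of a fourfold product, as the pentagon requires. *)
Lemma tensorll_day_ext (X Y : crossed_object Q A) (p : Q) (U U' V : A)
    (h h' : hom (T (T (day_ob X Y p) U) U') V) :
  (forall b c (e : b * c = p),
     bmap T (bmap T (day_in X Y e) (idm U)) (idm U') \; h
     = bmap T (bmap T (day_in X Y e) (idm U)) (idm U') \; h') -> h = h'.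
Proof.
move=> eh; apply: (coprod_ext
  (K := tensor_coprodl K (tensor_coprodl K (day_ob X Y p) U) U')).
by move=> -[[b c] e]; apply: eh.
Qed.

Lemma day_ext3l (X Y Z : crossed_object Q A) (a : Q) (V : A)
    (h h' : hom (day_ob (day_object X Y) Z a) V) :
  (forall b c d p (e1 : b * c = p) (e2 : p * d = a),
     bmap T (day_in X Y e1) (idm (Z d)) \; day_in (day_object X Y) Z e2 \; h
     = bmap T (day_in X Y e1) (idm (Z d)) \; day_in (day_object X Y) Z e2 \; h')
  -> h = h'.
Proof.
move=> eh; apply: day_ext => p d e2.
by apply: tensorl_day_ext => b c e1; apply: eh.
Qed.

Lemma day_ext3r (X Y Z : crossed_object Q A) (a : Q) (V : A)
    (h h' : hom (day_ob X (day_object Y Z) a) V) :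
  (forall b c d q (e3 : c * d = q) (e4 : b * q = a),
     bmap T (idm (X b)) (day_in Y Z e3) \; day_in X (day_object Y Z) e4 \; h
     = bmap T (idm (X b)) (day_in Y Z e3) \; day_in X (day_object Y Z) e4 \; h')
  -> h = h'.
Proof.
move=> eh; apply: day_ext => b q e4.
by apply: tensorr_day_ext => c d e3; apply: eh.
Qed.

(** * The associator, its equivariance and naturality, and the pentagon *)

Section Associator.
Variables X Y Z : crossed_object Q A.

Lemma assocl_eq (a : Q) (j : {j | factors a j}) (k : {k | factors (sval j).1 k}) :
  (sval k).1 * ((sval k).2 * (sval j).2) = a.
Proof. by rewrite mulgA (svalP k) (svalP j). Qed.

Lemma assocr_eq (a : Q) (j : {j | factors a j}) (k : {k | factors (sval j).2 k}) :
  ((sval j).1 * (sval k).1) * (sval k).2 = a.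
Proof. by rewrite -mulgA (svalP k) (svalP j). Qed.

Definition day_assoc_at (a : Q) :
    hom (day_ob (day_object X Y) Z a) (day_ob X (day_object Y Z) a) :=
  cotuple (day_ob (day_object X Y) Z a) (fun j : {j | factors a j} =>
    cotuple (tensor_coprodl K (day_ob X Y (sval j).1) (Z (sval j).2))
      (fun k : {k | factors (sval j).1 k} =>
        associator M _ _ _ \; bmap T (idm _) (day_in Y Z erefl)
        \; day_in X (day_object Y Z) (assocl_eq k))).

Definition day_assoc_inv_at (a : Q) :
    hom (day_ob X (day_object Y Z) a) (day_ob (day_object X Y) Z a) :=
  cotuple (day_ob X (day_object Y Z) a) (fun j : {j | factors a j} =>
    cotuple (tensor_coprodr B K (day_ob Y Z (sval j).2) (X (sval j).1))
      (fun k : {k | factors (sval j).2 k} =>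
        bwd (associator M _ _ _) \; bmap T (day_in X Y erefl) (idm _)
        \; day_in (day_object X Y) Z (assocr_eq k))).

(* Free p, q, a with equations, rather than b * c etc., make these usable at   *)
(* every nesting of the tensor product without transports.                    *)
Variables (b c d p q a : Q).
Hypotheses (e1 : b * c = p) (e2 : p * d = a) (e3 : c * d = q) (e4 : b * q = a).

Lemma day_assoc_atE :
  bmap T (day_in X Y e1) (idm (Z d)) \; day_in (day_object X Y) Z e2
    \; day_assoc_at a
  = associator M (X b) (Y c) (Z d) \; bmap T (idm (X b)) (day_in Y Z e3)
    \; day_in X (day_object Y Z) e4.
Proof.
subst p q; rewrite day_inK.
rewrite (coprod_inK (tensor_coprodl K (day_ob X Y (b * c)) (Z d))
  _ (exist _ (b, c) erefl)) /=.
by congr (_ \; _ \; day_in _ _ _); apply: Prop_irrelevance.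
Qed.

Lemma day_assoc_inv_atE :
  bmap T (idm (X b)) (day_in Y Z e3) \; day_in X (day_object Y Z) e4
    \; day_assoc_inv_at a
  = bwd (associator M (X b) (Y c) (Z d)) \; bmap T (day_in X Y e1) (idm (Z d))
    \; day_in (day_object X Y) Z e2.
Proof.
subst p q; rewrite day_inK.
rewrite (coprod_inK (tensor_coprodr B K (day_ob Y Z (c * d)) (X b))
  _ (exist _ (c, d) erefl)) /=.
by congr (_ \; _ \; day_in _ _ _); apply: Prop_irrelevance.
Qed.

End Associator.

(** The rule [day_actE] phrased with [fmap], the form in which equivariance goals present the
    action. *)
Lemma day_fmap_in (X Y : crossed_object Q A) (a a' : Q) (f : @hom QQ a a')
    (b c b' c' : Q) (e : b * c = a) (e' : b' * c' = a')
    (g : @hom QQ b b') (h : @hom QQ c c') :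
  sval g = sval f -> sval h = sval f ->
  day_in X Y e \; fmap (day_object X Y) f
  = bmap T (fmap X g) (fmap Y h) \; day_in X Y e'.
Proof. exact: day_actE. Qed.

Lemma day_bmap_in (X X' Y Y' : XA) (s : hom X X') (t : hom Y Y') (b c a : Q)
    (e : b * c = a) :
  day_in X Y e \; ntmap (bmap day_tensor s t) a
  = bmap T (ntmap s b) (ntmap t c) \; day_in X' Y' e.
Proof. exact: day_map_atE. Qed.

(** The summand formulas expect an injection tensored with an identity; these interchange laws bring
    composites into that shape. *)
Lemma bmap_splitl (X X' Y Y' Z : A) (f : hom X Y) (f' : hom Y Z) (g : hom X' Y') :
  bmap T (f \; f') g = bmap T f g \; bmap T f' (idm Y').
Proof. by rewrite -bmap_comp compm1. Qed.

Lemma bmap_rl (X X' Y Y' : A) (f : hom X Y) (g : hom X' Y') :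
  bmap T f g = bmap T (idm X) g \; bmap T f (idm Y').
Proof. by rewrite -bmap_comp comp1m compm1. Qed.

Lemma bmap_lr (X X' Y Y' : A) (f : hom X Y) (g : hom X' Y') :
  bmap T f g = bmap T f (idm X') \; bmap T (idm Y) g.
Proof. by rewrite -bmap_comp comp1m compm1. Qed.

Lemma bmap_splitr (X X' Y Y' Z : A) (f : hom X Y) (f' : hom Y Z) (g : hom X' Y') :
  bmap T g (f \; f') = bmap T g f \; bmap T (idm Y') f'.
Proof. by rewrite -bmap_comp compm1. Qed.

(** Conjugation by [x] is multiplicative, so it sends the triple [(b, c, d)] to a triple that
    indexes a summand in both bracketings. The rest is naturality of the associator of [A]. *)
Fact day_assoc_equivariant (X Y Z : crossed_object Q A) (a a' : QQ) (f : hom a a') :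
  fmap (day_object (day_object X Y) Z) f \; day_assoc_at X Y Z a'
  = day_assoc_at X Y Z a \; fmap (day_object X (day_object Y Z)) f.
Proof.
apply: day_ext3l => b c d p e1 e2; set x := sval f.
have e1' : b ^^ x * c ^^ x = p ^^ x by rewrite -pmq_conjMl e1.
have e2' : p ^^ x * d ^^ x = a' by rewrite -pmq_conjMl e2 -(svalP f).
have e3' : c ^^ x * d ^^ x = (c * d) ^^ x by rewrite -pmq_conjMl.
have e4 : b * (c * d) = a by rewrite mulgA e1.
have e4' : b ^^ x * (c * d) ^^ x = a' by rewrite -pmq_conjMl e4 -(svalP f).
rewrite (compA3 _ (day_assoc_atE _ _ _ e1 e2 erefl e4)) -!compA.
rewrite (day_fmap_in X (day_object Y Z) e4 e4'
  (g := acting b x) (h := acting (c * d) x)) //.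
rewrite (compA2 _ (day_fmap_in _ _ e2 e2' (g := acting p x) (h := acting d x) _ _)) //.
rewrite -!compA !bmap_comp_comp !comp1m.
rewrite (day_fmap_in _ _ e1 e1' (g := acting b x) (h := acting c x)) //.
rewrite (day_fmap_in _ _ erefl e3' (g := acting c x) (h := acting d x)) //.
rewrite bmap_splitl bmap_splitr -!compA (day_assoc_atE _ _ _ e1' e2' e3' e4').
by rewrite (compA2 _ (associator_nat _ _ _ _)) -compA.
Qed.

Definition day_assoc_hom (X Y Z : XA) :
    hom (day_tensor (day_tensor X Y) Z) (day_tensor X (day_tensor Y Z)).
Proof.
by exists (day_assoc_at X Y Z) => a a' f; apply: day_assoc_equivariant.
Defined.

Definition day_associator (X Y Z : XA) :
  iso (day_tensor (day_tensor X Y) Z) (day_tensor X (day_tensor Y Z)).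
Proof.
apply: (componentwise_iso (s := day_assoc_hom X Y Z) (v := day_assoc_inv_at X Y Z)) => a.
- apply: day_ext3l => b c d p e1 e2 /=.
  have e4 : b * (c * d) = a by rewrite mulgA e1.
  rewrite (compA3 _ (day_assoc_atE _ _ _ e1 e2 erefl e4)) compm1 -!compA.
  by rewrite (day_assoc_inv_atE _ _ _ e1 e2) fwdK_comp.
- apply: day_ext3r => b c d q e3 e4 /=.
  have e2 : b * c * d = a by rewrite -mulgA e3.
  rewrite (compA3 _ (day_assoc_inv_atE _ _ _ erefl e2 e3 e4)) compm1 -!compA.
  by rewrite (day_assoc_atE _ _ _ erefl e2 e3 e4) bwdK_comp.
Defined.

Fact day_associator_nat (X X' Y Y' Z Z' : XA)
    (s : hom X X') (t : hom Y Y') (u : hom Z Z') :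
  bmap day_tensor (bmap day_tensor s t) u \; day_associator X' Y' Z'
  = day_associator X Y Z \; bmap day_tensor s (bmap day_tensor t u).
Proof.
apply: nattrans_ext => a; apply: day_ext3l => b c d p e1 e2.
have e4 : b * (c * d) = a by rewrite mulgA e1.
rewrite /= (compA2 _ (day_bmap_in (bmap day_tensor s t) u e2)).
rewrite (compA3 _ (day_assoc_atE _ _ _ e1 e2 erefl e4)) -!compA.
rewrite (day_bmap_in s (bmap day_tensor t u) e4) !bmap_comp_comp !comp1m.
rewrite !day_bmap_in bmap_splitl bmap_splitr -!compA.
rewrite (day_assoc_atE _ _ _ e1 e2 erefl e4).
by rewrite (compA2 _ (associator_nat _ _ _ _)) -compA.
Qed.

Fact day_pentagon (W X Y Z : XA) :
  day_associator (day_tensor W X) Y Z \; day_associator W X (day_tensor Y Z)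
  = bmap day_tensor (day_associator W X Y) (idm Z)
    \; day_associator W (day_tensor X Y) Z
    \; bmap day_tensor (idm W) (day_associator X Y Z).
Proof.
apply: nattrans_ext => a; apply: day_ext => q d e3.
apply: tensorl_day_ext => p c e2; apply: tensorll_day_ext => x b e1 /=.
(* One equation for each further product occurring in the five bracketings of [(x, b, c, d)]. *)
have f1 : b * c = b * c by []. have f2 : c * d = c * d by [].
have f3 : x * (b * c) = q by rewrite mulgA e1.
have f4 : b * (c * d) = b * c * d by rewrite mulgA.
have f5 : x * (b * c * d) = a by rewrite mulgA f3.
have f6 : p * (c * d) = a by rewrite mulgA e2.
have g : b * c * d = b * c * d by [].
rewrite (compA3 _ (day_assoc_atE (day_object W X) Y Z e2 e3 f2 f6)) /= -!compA.
rewrite (compA2 _ (associator_nat M _ _ _)) bmap_id -!compA bmap_comp_comp.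
rewrite comp1m compm1 (bmap_rl (day_in W X e1)) -compA.
rewrite (day_assoc_atE W X (day_object Y Z) e1 f6 f4 f5) /=.
rewrite (compA2 _ (day_bmap_in (day_associator W X Y) (idm (Z : XA)) e3)) /=.
rewrite -!compA !bmap_comp_comp -!compA (day_assoc_atE W X Y e1 e2 f1 f3) /=.
rewrite !comp1m !bmap_splitl -!compA.
rewrite (compA3 _ (day_assoc_atE W (day_object X Y) Z f3 e3 g f5)) /= -!compA.
rewrite (day_bmap_in (idm (W : XA)) (day_associator X Y Z) f5) /=.
(* Written as a tensor of identities, this identity lets naturality of the associator apply. *)
rewrite -(bmap_id T (W x) (X b)).
rewrite (compA2 _ (associator_nat M (idm _) (idm _) (day_in Y Z f2))).
rewrite (compA2 _ (associator_nat M (idm _) (day_in X Y f1) (idm _))).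
rewrite -!compA !bmap_comp_comp !comp1m -!compA (day_assoc_atE X Y Z f1 g f2 f4).
rewrite (compA2 _ (pentagon M _ _ _ _)) -!compA.
by rewrite bmap_comp_comp !comp1m.
Qed.

(** * The unit object as a coproduct of copies of [I] *)

Lemma ecast_fwdK (C : category) (a b : C) (e : a = b) :
  ecast x (hom a x) e (idm a) \; ecast x (hom x a) e (idm a) = idm a.
Proof. by case: b / e; rewrite comp1m. Qed.

Lemma ecast_bwdK (C : category) (a b : C) (e : a = b) :
  ecast x (hom x a) e (idm a) \; ecast x (hom a x) e (idm a) = idm b.
Proof. by case: b / e; rewrite comp1m. Qed.

Definition day_unit_in (b : Q) (e : b = 1) : hom I (day_unit b) :=
  ecast c (hom I (day_unit c)) (esym e) (unit_in I cop).

Lemma day_unit_initial (b : Q) : b <> 1 ->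
  forall V : A, exists h : hom (day_unit b) V, forall h', h' = h.
Proof.
move=> /eqP/negbTE nb V; rewrite /= /day_unit_ob nb.
by exists (from_initial cop V) => h'; apply: from_initial_uniq.
Qed.

(** There is one copy of [I] when [b = 1], since equality proofs in [Q] are unique, and none
    otherwise, where the value is initial. *)
Lemma day_unit_universal (b : Q) (V : A) (f : b = 1 -> hom I V) :
  exists h : hom (day_unit b) V, (forall e, day_unit_in e \; h = f e)
    /\ (forall h', (forall e, day_unit_in e \; h' = f e) -> h' = h).
Proof.
have [e | /eqP ne] := eqVneq b 1.
  (* The inverse of the cast [unit_in], followed by the prescribed map at the only proof. *)
  subst b; exists (ecast J (hom J I) (esym (day_unit1 I cop)) (idm I) \; f erefl).
  split=> [e | h' eh].
    rewrite (eq_irrelevance e erefl) /day_unit_in /= compA.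
    by rewrite /unit_in ecast_fwdK comp1m.
  rewrite -eh compA.
  by rewrite /day_unit_in /unit_in /= ecast_bwdK comp1m.
by have [h uh] := day_unit_initial ne V; exists h.
Qed.

Definition day_unit_coprod (b : Q) : coproduct (fun _ : b = 1 => I).
Proof.
exists (day_unit b) (@day_unit_in b) (fun V f => sval (cid (day_unit_universal f))).
- by move=> V f e; case: (svalP (cid (day_unit_universal f))) => /(_ e).
- by move=> V f h eh; case: (svalP (cid (day_unit_universal f))) => _; apply.
Defined.

(** * The unitors and the triangle *)

Section Unitors.
Variable X : crossed_object Q A.

Lemma lunit_eq (a : Q) (j : {j | factors a j}) :
  (sval j).1 = 1 -> a = (sval j).2 ^^ 1.
Proof. by case: j => -[b c] /= ebc eb; rewrite pmq_conj1r -ebc eb mul1g. Qed.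

Lemma runit_eq (a : Q) (j : {j | factors a j}) :
  (sval j).2 = 1 -> a = (sval j).1 ^^ 1.
Proof. by case: j => -[b c] /= ebc ec; rewrite pmq_conj1r -ebc ec mulg1. Qed.

(** When [b = 1], the unitor of [A] lands in [X c] with [c = a]; the action of the element [1] takes
    it to [X a] in place of a cast. *)
Definition day_lunit_at (a : Q) : hom (day_ob day_unit X a) (X a) :=
  cotuple (day_ob day_unit X a) (fun j : {j | factors a j} =>
    cotuple (tensor_coprodl K (day_unit_coprod (sval j).1) (X (sval j).2))
      (fun e => lunitor M _ \;
         fmap X (exist _ 1 (lunit_eq e) : @hom QQ (sval j).2 a))).

Definition day_runit_at (a : Q) : hom (day_ob X day_unit a) (X a) :=
  cotuple (day_ob X day_unit a) (fun j : {j | factors a j} =>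
    cotuple (tensor_coprodr B K (day_unit_coprod (sval j).2) (X (sval j).1))
      (fun e => runitor M _ \;
         fmap X (exist _ 1 (runit_eq e) : @hom QQ (sval j).1 a))).

Lemma day_lunit_ext (a : Q) (V : A) (h h' : hom (day_ob day_unit X a) V) :
  (forall b c (e : b * c = a) (e1 : b = 1),
     bmap T (day_unit_in e1) (idm (X c)) \; day_in day_unit X e \; h
     = bmap T (day_unit_in e1) (idm (X c)) \; day_in day_unit X e \; h') ->
  h = h'.
Proof.
move=> eh; apply: day_ext => b c e.
apply: (coprod_ext (K := tensor_coprodl K (day_unit_coprod b) (X c))) => e1.
exact: eh.
Qed.

Lemma day_runit_ext (a : Q) (V : A) (h h' : hom (day_ob X day_unit a) V) :
  (forall b c (e : b * c = a) (e1 : c = 1),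
     bmap T (idm (X b)) (day_unit_in e1) \; day_in X day_unit e \; h
     = bmap T (idm (X b)) (day_unit_in e1) \; day_in X day_unit e \; h') ->
  h = h'.
Proof.
move=> eh; apply: day_ext => b c e.
apply: (coprod_ext (K := tensor_coprodr B K (day_unit_coprod c) (X b))) => e1.
exact: eh.
Qed.

Lemma day_lunit_atE (b c a : Q) (e : b * c = a) (e1 : b = 1) (g : @hom QQ c a) :
  sval g = 1 ->
  bmap T (day_unit_in e1) (idm (X c)) \; day_in day_unit X e \; day_lunit_at a
  = lunitor M (X c) \; fmap X g.
Proof.
move=> eg; rewrite day_inK.
rewrite (coprod_inK (tensor_coprodl K (day_unit_coprod b) (X c)) _ e1) /=.
by congr (_ \; _); apply: fmap_acting.
Qed.

Lemma day_runit_atE (b c a : Q) (e : b * c = a) (e1 : c = 1) (g : @hom QQ b a) :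
  sval g = 1 ->
  bmap T (idm (X b)) (day_unit_in e1) \; day_in X day_unit e \; day_runit_at a
  = runitor M (X b) \; fmap X g.
Proof.
move=> eg; rewrite day_inK.
rewrite (coprod_inK (tensor_coprodr B K (day_unit_coprod c) (X b)) _ e1) /=.
by congr (_ \; _); apply: fmap_acting.
Qed.

End Unitors.

Lemma day_unit_act_endo (f : @hom QQ 1 1) : fmap day_unit f = idm (day_unit 1).
Proof.
rewrite /= /day_unit_act; move: (day_unit_act_subproof f).
(* With the test abstracted both branches get proved, the false one by initiality. *)
rewrite /day_unit_ob; case: (1 == 1 :> Q) => // _.
exact: from_initial_uniq.
Qed.

Lemma day_unit_in_act (b b' : Q) (f : @hom QQ b b') (e : b = 1) (e' : b' = 1) :
  day_unit_in e \; fmap day_unit f = day_unit_in e'.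
Proof.
by subst b b'; rewrite day_unit_act_endo compm1.
Qed.

Definition day_lunit_inv_at (X : crossed_object Q A) (a : Q) :
    hom (X a) (day_ob day_unit X a) :=
  bwd (lunitor M (X a)) \; bmap T (day_unit_in erefl) (idm _)
  \; day_in day_unit X (mul1g a).

Definition day_runit_inv_at (X : crossed_object Q A) (a : Q) :
    hom (X a) (day_ob X day_unit a) :=
  bwd (runitor M (X a)) \; bmap T (idm _) (day_unit_in erefl)
  \; day_in X day_unit (mulg1 a).

Definition day_lunit_hom (X : XA) : hom (day_tensor day_unit X) X.
Proof.
exists (day_lunit_at X) => a a' f; apply: day_lunit_ext => b c e e1; set x := sval f.
have ec : c = a by rewrite -e e1 mul1g.
have e' : b ^^ x * c ^^ x = a' by rewrite -pmq_conjMl e -(svalP f).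
have e1' : b ^^ x = 1 by rewrite e1 pmq_conj1l.
have ga : a = c ^^ 1 by rewrite pmq_conj1r ec.
have ga' : a' = (c ^^ x) ^^ 1 by rewrite pmq_conj1r ec (svalP f).
pose g : @hom QQ c a := exist _ 1 ga.
pose g' : @hom QQ (c ^^ x) a' := exist _ 1 ga'.
rewrite (compA3 _ (day_lunit_atE X e e1 (g := g) erefl)) -compA.
rewrite -fmap_comp (compA2 _ (day_fmap_in day_unit X e e' (g := acting b x)
  (h := acting c x) erefl erefl)) -compA.
rewrite bmap_comp_comp (day_unit_in_act _ e1 e1') comp1m.
rewrite [bmap T _ (fmap X _)]bmap_rl -compA.
rewrite (day_lunit_atE X e' e1' (g := g') erefl).
rewrite (compA2 _ (lunitor_nat M _)) -!compA -!fmap_comp; congr (_ \; _).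
by apply: fmap_acting; rewrite /= mul1g mulg1.
Defined.

Definition day_runit_hom (X : XA) : hom (day_tensor X day_unit) X.
Proof.
exists (day_runit_at X) => a a' f; apply: day_runit_ext => b c e e1; set x := sval f.
have eb : b = a by rewrite -e e1 mulg1.
have e' : b ^^ x * c ^^ x = a' by rewrite -pmq_conjMl e -(svalP f).
have e1' : c ^^ x = 1 by rewrite e1 pmq_conj1l.
have ga : a = b ^^ 1 by rewrite pmq_conj1r eb.
have ga' : a' = (b ^^ x) ^^ 1 by rewrite pmq_conj1r eb (svalP f).
pose g : @hom QQ b a := exist _ 1 ga.
pose g' : @hom QQ (b ^^ x) a' := exist _ 1 ga'.
rewrite (compA3 _ (day_runit_atE X e e1 (g := g) erefl)) -compA.
rewrite -fmap_comp (compA2 _ (day_fmap_in X day_unit e e' (g := acting b x)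
  (h := acting c x) erefl erefl)) -compA.
rewrite bmap_comp_comp (day_unit_in_act _ e1 e1') comp1m.
rewrite [bmap T (fmap X _) _]bmap_lr -compA.
rewrite (day_runit_atE X e' e1' (g := g') erefl).
rewrite (compA2 _ (runitor_nat M _)) -!compA -!fmap_comp; congr (_ \; _).
by apply: fmap_acting; rewrite /= mul1g mulg1.
Defined.

Definition day_lunitor (X : XA) : iso (day_tensor day_unit X) X.
Proof.
apply: (componentwise_iso (s := day_lunit_hom X) (v := day_lunit_inv_at X)) => a.
- apply: day_lunit_ext => b c e e1 /=.
  have ec : c = a by rewrite -e e1 mul1g.
  subst c; subst b.
  rewrite (compA3 _ (day_lunit_atE X e erefl (g := idm (a : QQ)) erefl)) fmap_id !compm1.
  rewrite /day_lunit_inv_at fwdK_comp.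
  by congr (_ \; day_in _ _ _); apply: Prop_irrelevance.
- rewrite /= /day_lunit_inv_at -!compA.
  rewrite (day_lunit_atE X (mul1g a) erefl (g := idm (a : QQ)) erefl) fmap_id !compm1.
  by rewrite bwdK.
Defined.

Definition day_runitor (X : XA) : iso (day_tensor X day_unit) X.
Proof.
apply: (componentwise_iso (s := day_runit_hom X) (v := day_runit_inv_at X)) => a.
- apply: day_runit_ext => b c e e1 /=.
  have eb : b = a by rewrite -e e1 mulg1.
  subst b; subst c.
  rewrite (compA3 _ (day_runit_atE X e erefl (g := idm (a : QQ)) erefl)) fmap_id !compm1.
  rewrite /day_runit_inv_at fwdK_comp.
  by congr (_ \; day_in _ _ _); apply: Prop_irrelevance.
- rewrite /= /day_runit_inv_at -!compA.
  rewrite (day_runit_atE X (mulg1 a) erefl (g := idm (a : QQ)) erefl) fmap_id !compm1.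
  by rewrite bwdK.
Defined.

Fact day_lunitor_nat (X X' : XA) (s : hom X X') :
  bmap day_tensor (idm (day_unit : XA)) s \; day_lunitor X' = day_lunitor X \; s.
Proof.
apply: nattrans_ext => a; apply: day_lunit_ext => b c e e1 /=.
have ec : c = a by rewrite -e e1 mul1g.
subst c; subst b.
rewrite (compA3 _ (day_lunit_atE X e erefl (g := idm (a : QQ)) erefl)) fmap_id compm1.
rewrite (compA2 _ (day_bmap_in (idm (day_unit : XA)) s e)) /= -compA bmap_comp_comp.
rewrite comp1m compm1 bmap_rl -compA.
rewrite (day_lunit_atE X' e erefl (g := idm (a : QQ)) erefl) fmap_id compm1.
exact: lunitor_nat.
Qed.

Fact day_runitor_nat (X X' : XA) (s : hom X X') :
  bmap day_tensor s (idm (day_unit : XA)) \; day_runitor X' = day_runitor X \; s.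
Proof.
apply: nattrans_ext => a; apply: day_runit_ext => b c e e1 /=.
have eb : b = a by rewrite -e e1 mulg1.
subst b; subst c.
rewrite (compA3 _ (day_runit_atE X e erefl (g := idm (a : QQ)) erefl)) fmap_id compm1.
rewrite (compA2 _ (day_bmap_in s (idm (day_unit : XA)) e)) /= -compA bmap_comp_comp.
rewrite comp1m compm1 bmap_lr -compA.
rewrite (day_runit_atE X' e erefl (g := idm (a : QQ)) erefl) fmap_id compm1.
exact: runitor_nat.
Qed.

Fact day_triangle (X Y : XA) :
  day_associator X day_unit Y \; bmap day_tensor (idm X) (day_lunitor Y)
  = bmap day_tensor (day_runitor X) (idm Y).
Proof.
apply: nattrans_ext => a; apply: day_ext => p d e2.
apply: tensorl_day_ext => b c e1.
(* Only summands with middle index [1] remain, one for each proof [ec] of [c = 1]. *)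
apply: (coprod_ext (K := tensor_coprodl K
  (tensor_coprodr B K (day_unit_coprod c) (X b)) (Y d))) => ec /=.
have ep : b = p by rewrite -e1 ec mulg1.
subst b; subst c.
have e3 : 1 * d = d by rewrite mul1g.
rewrite [in LHS](compA3 _ (day_assoc_atE X day_unit Y e1 e2 e3 e2)) -!compA.
rewrite [in LHS](day_bmap_in (idm (X : XA)) (day_lunitor Y) e2).
rewrite [in RHS](day_bmap_in (day_runitor X) (idm (Y : XA)) e2) /=.
rewrite (compA2 _ (associator_nat M _ _ _)) -compA !bmap_comp_comp -!compA !comp1m.
rewrite (day_lunit_atE Y e3 erefl (g := idm (d : QQ)) erefl) fmap_id compm1.
rewrite (day_runit_atE X e1 erefl (g := idm (p : QQ)) erefl) fmap_id compm1.
by rewrite compA triangle.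
Qed.

Definition day_monoidal : monoidal_structure day_tensor day_unit :=
  Monoidal day_associator_nat day_lunitor_nat day_runitor_nat
    day_pentagon day_triangle.

(** * The braiding, its inverse and its naturality *)

Section Braiding.
Variables X Y : crossed_object Q A.

Lemma braid_eq (a : Q) (j : {j | factors a j}) :
  (sval j).2 * (sval j).1 ^^ (sval j).2 = a.
Proof. by rewrite pmq_braid_eq; apply: (svalP j). Qed.

Definition day_braid_at (a : Q) : hom (day_ob X Y a) (day_ob Y X a) :=
  cotuple (day_ob X Y a) (fun j : {j | factors a j} =>
    B (X (sval j).1) (Y (sval j).2)
    \; bmap T (idm _) (fmap X (acting (sval j).1 (sval j).2))
    \; day_in Y X (braid_eq j)).

Lemma day_braid_atE (b c b' a : Q) (e : b * c = a) (e' : c * b' = a)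
    (g : @hom QQ b b') : sval g = c ->
  day_in X Y e \; day_braid_at a
  = B (X b) (Y c) \; bmap T (idm (Y c)) (fmap X g) \; day_in Y X e'.
Proof.
case: g => c' /= eb ec; subst c' b'; rewrite day_inK /=.
by congr (_ \; bmap _ _ _ \; day_in _ _ _); apply: Prop_irrelevance.
Qed.

(** Bijectivity of (-)^c and invertibility of the action are mere existence statements; choice turns
    them into the data needed to define the inverse braiding. *)
Lemma unact (c b' : Q) : {b : Q & {gv : @hom QQ b b' * hom (X b') (X b) |
  [/\ sval gv.1 = c, fmap X gv.1 \; gv.2 = idm _ & gv.2 \; fmap X gv.1 = idm _]}}.
Proof.
have /cid[b eb] : exists b, b' = b ^^ c.
  by have [u _ uK] := pmq_conj_bij c; exists (u b'); rewrite uK.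
pose g : @hom QQ b b' := exist _ c eb.
have /cid[v [gv vg]] := crossed_iso X g.
by exists b, (g, v).
Qed.

Lemma unbraid_eq (a : Q) (j : {j | factors a j}) :
  tag (unact (sval j).1 (sval j).2) * (sval j).1 = a.
Proof.
case: j => -[c b'] /= e; case: (unact c b') => b [[[c' eb] v] /= [ec _ _]].
by subst c' b'; rewrite -e pmq_braid_eq.
Qed.

Definition day_unbraid_at (a : Q) : hom (day_ob Y X a) (day_ob X Y a) :=
  cotuple (day_ob Y X a) (fun j : {j | factors a j} =>
    bmap T (idm _) (sval (tagged (unact (sval j).1 (sval j).2))).2
    \; bwd (B _ _) \; day_in X Y (unbraid_eq j)).

(** Any preimage [b] and inverse [v] may be used: injectivity of (-)^c and uniqueness of inverses
    identify them with those chosen by [unact]. *)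
Lemma day_unbraid_atE (b c b' a : Q) (e : b * c = a) (e' : c * b' = a)
    (g : @hom QQ b b') (v : hom (X b') (X b)) : sval g = c ->
  fmap X g \; v = idm _ -> v \; fmap X g = idm _ ->
  day_in Y X e' \; day_unbraid_at a
  = bmap T (idm (Y c)) v \; bwd (B (X b) (Y c)) \; day_in X Y e.
Proof.
move=> eg gv vg; rewrite day_inK /=; move: (unbraid_eq _) => /=.
case: (unact c b') => b0 [[g0 v0] /= [eg0 gv0 vg0]] e0.
have eb : b0 = b.
  apply: (bij_inj (pmq_conj_bij c)).
  by rewrite -{1}eg0 -eg -(svalP g) -(svalP g0).
subst b0; rewrite (fmap_acting X (g := g)) ?eg0 // in gv0 vg0.
have -> : v0 = v by rewrite -(comp1m v0) -vg -compA gv0 compm1.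
by congr (_ \; _ \; day_in _ _ _); apply: Prop_irrelevance.
Qed.

End Braiding.

(** Both paths take [X b] to the value of [X] at (b^c)^x = (b^x)^(c^x). One acts by c x and the
    other by x c^x, which are equal. *)
Definition day_braid_hom (X Y : XA) : hom (day_tensor X Y) (day_tensor Y X).
Proof.
exists (day_braid_at X Y) => a a' f; apply: day_ext => b c e; set x := sval f.
have e1 : c * b ^^ c = a by rewrite pmq_braid_eq.
have e' : b ^^ x * c ^^ x = a' by rewrite -pmq_conjMl e -(svalP f).
have e1' : c ^^ x * (b ^^ c) ^^ x = a' by rewrite -pmq_conjMl e1 -(svalP f).
pose g : @hom QQ (b ^^ x) ((b ^^ c) ^^ x) := exist _ (c ^^ x) (pmq_conjJ b c x).
rewrite (compA2 _ (day_braid_atE X Y e e1 (g := acting b c) erefl)) -!compA.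
rewrite (day_fmap_in Y X e1 e1' (g := acting c x) (h := acting (b ^^ c) x)) //.
rewrite (compA2 _ (day_fmap_in X Y e e' (g := acting b x) (h := acting c x) _ _)) //.
rewrite -compA (day_braid_atE X Y e' e1' (g := g)) //.
rewrite (compA2 _ (br_nat B _ _)) -!compA !bmap_comp_comp comp1m compm1 -!fmap_comp.
congr (_ \; bmap _ _ _ \; _); apply: fmap_acting => /=.
by rewrite -pmq_mul_conj.
Defined.

Definition day_br (X Y : XA) : iso (day_tensor X Y) (day_tensor Y X).
Proof.
apply: (componentwise_iso (s := day_braid_hom X Y) (v := day_unbraid_at X Y)) => a.
- apply: day_ext => b c e /=.
  have e1 : c * b ^^ c = a by rewrite pmq_braid_eq.
  have [v [gv vg]] := crossed_iso X (acting b c).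
  rewrite (compA2 _ (day_braid_atE X Y e e1 (g := acting b c) erefl)) -!compA.
  rewrite (day_unbraid_atE Y e e1 (g := acting b c) erefl gv vg).
  by rewrite bmap_comp_comp gv comp1m bmap_id comp1m fwdK_comp compm1.
- apply: day_ext => c b' e' /=.
  have [b [[g v] /= [eg gv vg]]] := unact X c b'.
  have e : b * c = a by rewrite -pmq_braid_eq -eg -(svalP g) eg.
  rewrite (compA2 _ (day_unbraid_atE Y e e' eg gv vg)) -!compA.
  rewrite (day_braid_atE X Y e e' eg) bwdK_comp.
  by rewrite bmap_comp_comp vg comp1m bmap_id comp1m compm1.
Defined.

Fact day_br_nat (X X' Y Y' : XA) (s : hom X X') (t : hom Y Y') :
  bmap day_tensor s t \; day_br X' Y' = day_br X Y \; bmap day_tensor t s.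
Proof.
apply: nattrans_ext => a; apply: day_ext => b c e /=.
have e1 : c * b ^^ c = a by rewrite pmq_braid_eq.
rewrite (compA2 _ (day_braid_atE X Y e e1 (g := acting b c) erefl)) -!compA.
rewrite (compA2 _ (day_bmap_in s t e)) -!compA.
rewrite (day_braid_atE X' Y' e e1 (g := acting b c) erefl) (day_bmap_in t s e1).
rewrite (compA2 _ (br_nat B _ _)) -!compA !bmap_comp_comp comp1m compm1.
by rewrite ntmap_nat.
Qed.

(** * The hexagons *)

Fact day_hexagon1 (X Y Z : XA) :
  associator day_monoidal X Y Z \; day_br X (day_tensor Y Z)
    \; associator day_monoidal Y Z X
  = bmap day_tensor (day_br X Y) (idm Z) \; associator day_monoidal Y X Z
    \; bmap day_tensor (idm Y) (day_br X Z).
Proof.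
apply: nattrans_ext => a; apply: day_ext3l => b c d p e1 e2 /=.
have f1 : b * (c * d) = a by rewrite mulgA e1.
(* Braiding [X] past [Y] and [Z] together acts by [c * d]; one at a time it acts by [c], then by [d]
   through [g] below. Both end at the same index. *)
have f2 : c * d * b ^^ (c * d) = a by rewrite pmq_braid_eq.
have f3 : d * b ^^ (c * d) = b ^^ c * d by rewrite pmq_conjMr pmq_braid_eq.
have f4 : c * (b ^^ c * d) = a by rewrite mulgA pmq_braid_eq e1.
have f5 : c * b ^^ c = p by rewrite pmq_braid_eq.
pose g : @hom QQ (b ^^ c) (b ^^ (c * d)) := exist _ d (pmq_conjMr b c d).
rewrite (compA3 _ (day_assoc_atE X Y Z e1 e2 erefl f1)) -!compA.
rewrite (compA2 _ (day_braid_atE X (day_object Y Z) f1 f2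
  (g := acting b (c * d)) erefl)) -!compA /=.
rewrite [in RHS](compA2 _ (day_bmap_in (day_br X Y) (idm (Z : XA)) e2)) /= -!compA.
rewrite !bmap_comp_comp comp1m (day_braid_atE X Y e1 f5 (g := acting b c) erefl).
rewrite !bmap_splitl -!compA.
rewrite [in RHS](compA3 _ (day_assoc_atE Y X Z f5 e2 erefl f4)) /= -!compA.
rewrite (day_bmap_in (idm (Y : XA)) (day_br X Z) f4) /=.
rewrite [in RHS](compA2 _ (associator_nat M _ _ _)) -!compA.
rewrite !bmap_comp_comp !comp1m -!compA.
rewrite (day_braid_atE X Z erefl f3 (g := g) erefl).
rewrite [in RHS](compA2 _ (br_nat B _ _)) -!compA bmap_comp_comp !comp1m.
rewrite -fmap_comp (compA2 _ (br_nat B _ _)) -!compA bmap_comp_comp comp1m compm1.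
rewrite [in LHS]bmap_rl -!compA (day_assoc_atE Y Z X erefl f2 f3 f4).
rewrite -[in LHS](bmap_id T (Y c) (Z d)).
rewrite (compA2 _ (associator_nat M _ _ _)) -!compA bmap_comp_comp comp1m.
rewrite (fmap_acting X (f := acting b c \; g) (g := acting b (c * d))) //.
by rewrite [in RHS]bmap_splitr -!compA [in LHS](compA3 _ (hexagon1 B _ _ _)) -!compA.
Qed.

Lemma associator_bwd_nat (U U' V V' W W' : A)
    (f : hom U U') (g : hom V V') (h : hom W W') :
  bmap T f (bmap T g h) \; bwd (associator M U' V' W')
  = bwd (associator M U V W) \; bmap T (bmap T f g) h.
Proof. exact: iso_bwd_nat (associator_nat M f g h). Qed.

(** Here [d] acts on the Day convolution of [X] and [Y]. That action is diagonal, so it splits into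
    the actions on [X b] and [Y c] produced by the two single braidings. *)
Fact day_hexagon2 (X Y Z : XA) :
  bwd (associator day_monoidal X Y Z) \; day_br (day_tensor X Y) Z
    \; bwd (associator day_monoidal Z X Y)
  = bmap day_tensor (idm X) (day_br Y Z) \; bwd (associator day_monoidal X Z Y)
    \; bmap day_tensor (day_br X Z) (idm Y).
Proof.
apply: nattrans_ext => a; apply: day_ext3r => b c d q e3 e4 /=.
have f2 : b * c * d = a by rewrite -mulgA e3.
have f3 : d * (b * c) ^^ d = a by rewrite pmq_braid_eq.
have f4 : b ^^ d * c ^^ d = (b * c) ^^ d by rewrite pmq_conjMl.
have f5 : d * b ^^ d = b * d by rewrite pmq_braid_eq.
have f6 : b * d * c ^^ d = a by rewrite -mulgA pmq_braid_eq e3.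
have f7 : d * c ^^ d = q by rewrite pmq_braid_eq.
rewrite (compA3 _ (day_assoc_inv_atE X Y Z erefl f2 e3 e4)) -!compA.
rewrite (compA2 _ (day_braid_atE (day_object X Y) Z f2 f3
  (g := acting (b * c) d) erefl)) -!compA.
rewrite [in LHS](compA2 _ (br_nat B _ _)) -!compA bmap_comp_comp comp1m.
rewrite (day_fmap_in X Y erefl f4 (g := acting b d) (h := acting c d)) //=.
rewrite bmap_splitr -!compA (day_assoc_inv_atE Z X Y f5 f6 f4 f3).
rewrite [in LHS](compA2 _ (associator_bwd_nat _ _ _)) -!compA.
rewrite [in RHS](compA2 _ (day_bmap_in (idm (X : XA)) (day_br Y Z) e4)) /= -!compA.
rewrite [in RHS]bmap_comp_comp comp1m.
rewrite (day_braid_atE Y Z e3 f7 (g := acting c d) erefl).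
rewrite 2![in RHS]bmap_splitr -!compA.
rewrite [in RHS](compA3 _ (day_assoc_inv_atE X Z Y erefl f6 f7 e4)) -!compA.
rewrite (day_bmap_in (day_br X Z) (idm (Y : XA)) f6) /=.
rewrite [in RHS](compA2 _ (associator_bwd_nat _ _ _)) -!compA !bmap_comp_comp.
rewrite bmap_id comp1m !compm1 (day_braid_atE X Z erefl f5 (g := acting b d) erefl).
(* Separates the braiding of [X b] with [Z d], the last factor of the second hexagon of [A], from
   the actions after it. *)
rewrite -[fmap Y _ in RHS]comp1m bmap_comp -!compA.
by rewrite [in LHS](compA3 _ (hexagon2 B _ _ _)) -!compA.
Qed.

Definition day_braiding : braiding day_monoidal :=
  Braiding day_br_nat day_hexagon1 day_hexagon2.

End DayBraided.

Theorem proposition6 (Q : completePMQType)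
    (A : category) (T : bifunctor A) (I : A) (M : monoidal_structure T I)
    (B : braiding M) (K : closed_structure T)
    (cop : subset_coproducts A (Q * Q)) :
  exists (M' : monoidal_structure (day_tensor T cop) (day_unit I cop))
         (B' : braiding M'),
    [/\ forall (X Y Z : crossed_object Q A) (b c d : Q),
          bmap T (day_in T cop X Y (erefl (b * c))) (idm (Z d))
          \; day_in T cop (day_object T cop X Y) Z (erefl (b * c * d))
          \; component (associator M' X Y Z) (b * c * d)
          = associator M (X b) (Y c) (Z d)
            \; bmap T (idm (X b)) (day_in T cop Y Z (erefl (c * d)))
            \; day_in T cop X (day_object T cop Y Z) (mulgA b c d),
        forall (X : crossed_object Q A) (a : Q),
          bmap T (unit_in I cop) (idm (X a))
          \; day_in T cop (day_unit I cop) X (mul1g a)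
          \; component (lunitor M' X) a
          = lunitor M (X a),
        forall (X : crossed_object Q A) (a : Q),
          bmap T (idm (X a)) (unit_in I cop)
          \; day_in T cop X (day_unit I cop) (mulg1 a)
          \; component (runitor M' X) a
          = runitor M (X a)
      & forall (X Y : crossed_object Q A) (b c : Q),
          day_in T cop X Y (erefl (b * c)) \; component (B' X Y) (b * c)
          = B (X b) (Y c)
            \; bmap T (idm (Y c)) (fmap X (acting b c))
            \; day_in T cop Y X (pmq_braid_eq b c)].
Proof.
exists (day_monoidal B K cop), (day_braiding B K cop); split.
- move=> X Y Z b c d; exact: day_assoc_atE.
- move=> X a.
  have := day_lunit_atE M K cop X (mul1g a) erefl
    (g := idm (a : action_category Q)) erefl.
  by rewrite fmap_id compm1.
- move=> X a.
  have := day_runit_atE B K cop X (mulg1 a) erefl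
    (g := idm (a : action_category Q)) erefl.
  by rewrite fmap_id compm1.
- move=> X Y b c.
  exact: (day_braid_atE B cop X Y erefl (pmq_braid_eq b c) (g := acting b c) erefl).
Qed.
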